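(* Let $\Omega\subset X$ be a bounded connected open set satisfying the following condition: for every collection $\mathcal{F}$ of ends of $\Omega$ that is totally ordered by division (with $x\le y$ if and only if $x$ divides $y$) there is an end $[\{G_k\}_k]$ of $\Omega$ such that $[\{G_k\}_k]\le[\{F_k\}_k]$ for every $[\{F_k\}_k]\in\mathcal{F}$. Let $V\subset\Omega$ be an open, connected set. If $\partial\Omega\cap\partial V$ is non-empty, then there is a prime end of $\Omega$ from the side of $V$.
   Context: Setting: $1<p<\infty$ is fixed; $(X,d)$ is a complete geodesic metric space (any two points $x,y$ are joined by a curve of length $d(x,y)$) equipped with a doubling measure $\mu$ (there is $C\ge1$ with $\mu(2B)\le C\mu(B)$ for every ball $B$; balls have positive finite measure) supporting a $p$-Poincar\'e inequality: there are $C,\lambda\ge1$ such that for every function $u$ on $X$ with upper gradient $g$ and every ball $B$, $\frac1{\mu(B)}\int_B|u-u_B|\,d\mu\le C\,\mathrm{rad}(B)\big(\frac1{\mu(\lambda B)}\int_{\lambda B}g^p\,d\mu\big)^{1/p}$, where $u_B=\frac1{\mu(B)}\int_Bu\,d\mu$. (A Borel function $g\ge 0$ is an upper gradient of $u$ if $|u(x)-u(y)|\le\int_\gamma g\,ds$ for every non-constant compact rectifiable curve $\gamma$ with end points $x,y$, with $\int_\gamma g\,ds=\infty$ required if $u(x)$ or $u(y)$ is not finite.) Closures and boundaries are taken in $X$. Mazurkiewicz distance: for $x,y\in\Omega$, $d_M(x,y)=\inf_E\operatorname{diam}E$, the infimum over all connected sets $E\subset\Omega$ with $x,y\in E$. For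 $A,B\subset\Omega$, $\operatorname{dist}_M(A,B)=\inf\{d_M(a,b):a\in A,b\in B\}$. Ends: a set $E\subset\Omega$ is acceptable if $E$ is connected and $\overline E\cap\partial\Omega\ne\varnothing$. A sequence $\{E_k\}_{k\in\mathbb{N}}$ of acceptable sets is a chain if (a) $E_{k+1}\subset E_k$ for all $k$; (b) $\operatorname{dist}_M(\Omega\cap\partial E_k,\Omega\cap\partial E_{k+1})>0$ for all $k$; (c) the impression $I(\{E_k\}_k)=\bigcap_k\overline{E_k}$ is a subset of $\partial\Omega$. A chain $\{E_k\}_k$ divides a chain $\{F_k\}_k$ if for each $k$ there is $j_k$ with $E_{j_k}\subset F_k$; two chains are equivalent if each divides the other. Equivalence classes $[\{E_k\}_k]$ are called ends of $\Omega$; divisibility descends to ends. An end is a prime end if the only end that divides it is itself. A chain $\{E_k\}_k$ of $\Omega$ is from the side of $V$ if $E_k\cap V\ne\varnothing$ for every $k$; this property does not depend on the representative chain, and so is a property of ends. *)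

(* Defs.v *)
From HB Require Import structures.
From mathcomp Require Import all_boot all_order all_algebra.
From mathcomp Require Import all_classical all_reals all_analysis measurable_realfun.

Set Implicit Arguments.
Unset Strict Implicit.
Unset Printing Implicit Defensive.

Import Order.TTheory GRing.Theory Num.Theory.
Import numFieldTopology.Exports numFieldNormedType.Exports.

Local Open Scope classical_set_scope.
Local Open Scope ring_scope.

(* The library's [Complete] class also provides a base point, so these spaces
   are nonempty; the base point is needed by [measurableType]. *)
#[short(type="completeMetricType")]
HB.structure Definition CompleteMetric (R : numDomainType) :=
  {T of Metric R T & Complete T}.

(* X with its Borel sigma-algebra *)
Notation borel X := (g_sigma_algebraType (@open X)).

Definition boundary (T : topologicalType) (A : set T) : set T :=
  closure A `\` A°.

Section Metric.
Context {R : realType} {X : metricType R}.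
Implicit Types (A : set X) (gam : R -> X) (a b s : R) (x y : X).

(* diam set0 = -oo *)
Definition diam A : \bar R :=
  ereal_sup [set (mdist x y)%:E | x in A & y in A].

(* A compact curve is given by a <= b and a map gam : R -> X, of which only the
   restriction to [a, b] matters. *)
Definition curve a b gam : Prop :=
  a <= b /\ {within `[a, b], continuous gam}.

Definition curve_length a b gam : \bar R :=
  ereal_sup
    [set (\sum_(i < size s) mdist (gam (nth b (a :: s) i))
                                  (gam (nth b (a :: s) i.+1)))%:E
    | s in itv_partition a b].

Definition rectifiable a b gam : Prop := (curve_length a b gam < +oo)%E.

Definition nonconstant a b gam : Prop :=
  exists s t, [/\ a <= s <= b, a <= t <= b & gam s != gam t].

(* Parametrization by arc length: the point of gam at arc length s from gam a.
   Any t such that gam has length s on [a, t] gives the same point gam t. *)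
Definition arc_length_param a b gam : R -> X := fun s =>
  gam (xget a [set t | a <= t <= b /\ curve_length a t gam = s%:E]).

(* The integral of g ds along a rectifiable curve *)
Definition line_integral (g : X -> \bar R) a b gam : \bar R :=
  (\int[lebesgue_measure]_(s in `[0%R, fine (curve_length a b gam)])
     g (arc_length_param a b gam s))%E.

Definition geodesic_space : Prop :=
  forall x y, exists a b gam,
    [/\ curve a b gam, gam a = x, gam b = y
      & curve_length a b gam = (mdist x y)%:E].

End Metric.

Arguments geodesic_space {R} X.

Section Poincare.
Context {R : realType} {X : completeMetricType R}.
Implicit Types (mu : {measure set (borel X) -> \bar R}) (p : R).

Definition upper_gradient (u g : X -> \bar R) : Prop :=
  [/\ measurable_fun [set: borel X] (g : borel X -> \bar R),
      forall x, (0 <= g x)%E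
    & forall a b gam, curve a b gam -> rectifiable a b gam ->
        nonconstant a b gam ->
        if (u (gam a) \is a fin_num) && (u (gam b) \is a fin_num)
        then (`|u (gam a) - u (gam b)| <= line_integral g a b gam)%E : Prop
        else line_integral g a b gam = +oo%E].

Definition average mu (B : set X) (f : X -> \bar R) : \bar R :=
  ((fine (mu B))^-1%:E * \int[mu]_(y in B) f y)%E.

Definition doubling_measure mu : Prop :=
  (forall (x : X) (r : R), 0 < r -> (0 < mu (ball x r) < +oo)%E) /\
  (exists2 C : R, 1 <= C &
     forall (x : X) (r : R), 0 < r ->
       (mu (ball x (2 * r)) <= C%:E * mu (ball x r))%E).

(* If the integral of u over the ball is infinite or of the form oo - oo, then
   the average of u is infinite and the left-hand side below is +oo, which is
   the usual convention. *)
Definition poincare_inequality mu p : Prop :=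
  exists C lam : R, [/\ 1 <= C, 1 <= lam &
    forall u g : X -> \bar R,
      measurable_fun [set: borel X] (u : borel X -> \bar R) ->
      upper_gradient u g ->
      forall (x : X) (r : R), 0 < r ->
        (average mu (ball x r) (fun y => `|u y - average mu (ball x r) u|)
         <= C%:E * r%:E
            * (average mu (ball x (lam * r)) (fun y => g y `^ p)) `^ p^-1)%E].

End Poincare.

Section Ends.
Context {R : realType} {X : metricType R}.
Implicit Types (Omega A B V : set X) (E F : nat -> set X).

(* The Mazurkiewicz distance *)
Definition mazurkiewicz_dist Omega (x y : X) : \bar R :=
  ereal_inf [set diam A | A in
    [set A | [/\ connected A, A `<=` Omega, A x & A y]]].

Definition mazurkiewicz_set_dist Omega A B : \bar R :=
  ereal_inf [set mazurkiewicz_dist Omega a b | a in A & b in B].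

Definition acceptable Omega A : Prop :=
  [/\ A `<=` Omega, connected A & closure A `&` boundary Omega !=set0].

Definition impression E : set X := \bigcap_k closure (E k).

Definition chain Omega E : Prop :=
  [/\ forall k, acceptable Omega (E k),
      forall k, E k.+1 `<=` E k,
      forall k, (0 < mazurkiewicz_set_dist Omega
                       (Omega `&` boundary (E k))
                       (Omega `&` boundary (E k.+1)))%E
    & impression E `<=` boundary Omega].

Definition divides E F : Prop := forall k, exists j, E j `<=` F k.

Definition equiv_chain E F : Prop := divides E F /\ divides F E.

Definition chain_class Omega E : set (nat -> set X) :=
  [set F | chain Omega F /\ equiv_chain E F].

Definition ends Omega : set (set (nat -> set X)) :=
  [set chain_class Omega E | E in chain Omega].

Implicit Types e f : set (nat -> set X).

Definition end_divides e f : Prop :=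
  exists E F, [/\ e E, f F & divides E F].

Definition prime_end Omega e : Prop :=
  ends Omega e /\ forall f, ends Omega f -> end_divides f e -> f = e.

Definition from_side V E : Prop := forall k, E k `&` V !=set0.

Definition end_from_side V e : Prop := exists2 E, e E & from_side V E.

Lemma divides_refl E : divides E E.
Proof. by move=> k; exists k. Qed.

Lemma divides_trans E F G : divides E F -> divides F G -> divides E G.
Proof.
move=> EF FG k; have [j FGk] := FG k; have [i EFj] := EF j.
by exists i; exact: subset_trans EFj FGk.
Qed.

Lemma chain_class_refl Omega E : chain Omega E -> chain_class Omega E E.
Proof. by move=> cE; split=> //; split; exact: divides_refl. Qed.

(* Divisibility and being from the side of V do not depend on representatives *)
Lemma end_dividesE Omega E F : chain Omega E -> chain Omega F ->
  end_divides (chain_class Omega E) (chain_class Omega F) <-> divides E F.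
Proof.
move=> cE cF; split=> [[E' [F' [[_ [EE' _]] [_ [_ F'F]] E'F']]]|EF].
  exact: divides_trans EE' (divides_trans E'F' F'F).
by exists E, F; split=> //; exact: chain_class_refl.
Qed.

Lemma end_from_sideE Omega V E : chain Omega E ->
  end_from_side V (chain_class Omega E) <-> from_side V E.
Proof.
move=> cE; split=> [[F [_ [_ FE]] Fs] k|Es].
  by have [j FEk] := FE k; have [x [/FEk Ex Vx]] := Fs j; exists x.
by exists E => //; exact: chain_class_refl.
Qed.

End Ends.

(* Main.v *)
Require Import Defs.
From mathcomp Require Import all_boot all_order all_algebra.
From mathcomp Require Import all_classical all_reals all_analysis measurable_realfun.
From mathcomp Require Import lra.

(** Write depth x for the distance from x to the complement of Omega.  For
    d > 0 let the d-collar consist of the points of Omega of depth less than d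
    that lie at Mazurkiewicz distance less than d from V.

    A chain is built from components of shrinking collars.  Let x0 be a common
    boundary point of Omega and V, fix v0 in V, and let d_k = depth v0 / (k+1).
    Collars are open and balls of a geodesic space are connected, so a boundary
    point in Omega of a component of the d_k-collar lies outside that collar.
    Both depth and the Mazurkiewicz distance to V are 1-Lipschitz for d_M, so
    components of the d_k- and d_(k+1)-collars have boundaries at Mazurkiewicz
    distance at least d_k - d_(k+1) ([component_separation]).  Since
    the depth on the k-th set is at most d_k, the impression lies in the boundary
    of Omega.  The chain exists as soon as the components can be chosen nested,
    with the part of each in V accumulating at x0.  The danger is that V reaches
    x0 through infinitely many components of the collar.  But as V is connected
    and contains v0, each component met by V near x0 contains a point of V of
    depth exactly d/2 ([collar_component_level]); Omega is totally bounded, so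
    one small ball contains such points for arbitrarily small
    distances to x0, and this ball lies in the collar and glues the
    corresponding components into one ([component_meets_near]).

    The resulting chain E has a property much stronger than meeting V: every
    chain F that divides E is from the side of V ([divides_from_side]).  Indeed,
    for large indices the points of F are joined to V by connected sets of
    diameter tending to 0.  If F_j missed V, such a set would cross both the
    boundary of F_j and that of F_(j+1), whose Mazurkiewicz distance is
    positive.

    So it is enough to have some prime end that divides the end of E, and
    Zorn's lemma provides one ([prime_end_divides]): a minimal end below the
    given one is minimal among all ends. *)

Set Implicit Arguments.
Unset Strict Implicit.
Unset Printing Implicit Defensive.

Import Order.TTheory GRing.Theory Num.Theory.
Import numFieldTopology.Exports numFieldNormedType.Exports.

Local Open Scope classical_set_scope.
Local Open Scope ring_scope.

(** * Connected sets *)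

Section Topology.
Context {T : topologicalType}.
Implicit Types A B : set T.

(** A connected set that misses the boundary of B meets B in a set that is
    relatively open, through the interior of B, and relatively closed, through
    its closure. *)
Lemma connected_boundary A B x y : connected A ->
  A x -> B x -> A y -> ~ B y -> A `&` boundary B !=set0.
Proof.
move=> cA Ax Bx Ay nBy; apply: contrapT => AB0; apply: nBy.
have clB z : A z -> closure B z -> B° z.
  by move=> Az Bz; apply: contrapT => nBz; apply: AB0; exists z.
suff AB : A `&` B = A by move: Ay; rewrite -AB => -[].
apply: cA.
- by exists x.
- exists B°; first exact: open_interior.
  apply/seteqP; split=> z [Az Bz]; split=> //.
    by apply: clB => //; exact: subset_closure.
  exact: interior_subset.
- exists (closure B); first exact: closed_closure.
  apply/seteqP; split=> z [Az Bz]; split=> //; first exact: subset_closure.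
  exact: interior_subset (clB _ Az Bz).
Qed.

Lemma connected_star A x :
  (forall y, A y -> exists C, [/\ connected C, C `<=` A, C x & C y]) ->
  connected A.
Proof.
move=> Astar; suff -> : A = connected_component A x.
  exact: component_connected.
apply/seteqP; split; last exact: connected_component_sub.
by move=> y /Astar[C [cC CA Cx Cy]]; exists C.
Qed.

Lemma component_mono (O O' : set T) x : O' `<=` O ->
  connected_component O' x `<=` connected_component O x.
Proof.
move=> O'O y [B [Bx BO' cB] By]; exists B => //; split=> //.
exact: subset_trans O'O.
Qed.

End Topology.

(** * Diameters and balls *)

Section Metric.
Context {R : realType} {X : metricType R}.
Implicit Types (A B : set X) (x y z : X) (r s : R).

Lemma closure_mdistP A x :
  closure A x <-> forall r, 0 < r -> exists2 y, A y & mdist x y < r.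
Proof.
split=> [Ax r r0|Ax B /nbhs_ballP[r /= r0 rB]].
  by have [y [Ay]] := Ax _ (nbhsx_ballx x r r0); rewrite ballEmdist; exists y.
have [y Ay xy] := Ax r r0; exists y; split=> //; apply: rB.
by rewrite ballEmdist.
Qed.

Lemma open_mdistP A :
  open A <-> forall x, A x -> exists2 r, 0 < r & ball x r `<=` A.
Proof.
rewrite openE; split=> [oA x /oA /nbhs_ballP[r /= r0 rA]|oA x /oA[r r0 rA]].
  by exists r.
by apply/nbhs_ballP; exists r.
Qed.

Lemma open_mball x r : open (ball x r).
Proof.
apply/open_mdistP => y; rewrite ballEmdist /= => xyr.
exists (r - mdist x y); first by rewrite subr_gt0.
move=> z; rewrite ballEmdist /= => yz.
by have := metric_triangle x y z; lra.
Qed.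

Lemma mdist_le_diam A x y : A x -> A y -> ((mdist x y)%:E <= diam A)%E.
Proof. by move=> Ax Ay; apply: ereal_sup_ubound; exists x => //; exists y. Qed.

Lemma diam_fin A x r : A x -> (diam A < r%:E)%E ->
  exists2 s, s < r & diam A = s%:E.
Proof.
move=> Ax; have := mdist_le_diam Ax Ax.
by case: (diam A) => // s _; rewrite lte_fin; exists s.
Qed.

Lemma diam_setU A B y r s : A y -> B y ->
  (diam A < r%:E)%E -> (diam B < s%:E)%E -> (diam (A `|` B) < (r + s)%:E)%E.
Proof.
move=> Ay By /(diam_fin Ay)[r' r'r dA] /(diam_fin By)[s' s's dB].
apply: (@le_lt_trans _ _ (r' + s')%:E); last by rewrite lte_fin ltrD.
have hA u v : A u -> A v -> mdist u v <= r'.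
  by move=> Au Av; rewrite -lee_fin -dA mdist_le_diam.
have hB u v : B u -> B v -> mdist u v <= s'.
  by move=> Bu Bv; rewrite -lee_fin -dB mdist_le_diam.
have r'0 := hA _ _ Ay Ay; have s'0 := hB _ _ By By.
rewrite mdistxx in r'0 s'0.
apply: ge_ereal_sup => _ [u ABu [v ABv <-]]; rewrite lee_fin.
have tri := metric_triangle u y v.
case: ABu ABv => [Au|Bu] [Av|Bv].
- by have := hA _ _ Au Av; lra.
- by have := hA _ _ Au Ay; have := hB _ _ By Bv; lra.
- by have := hB _ _ Bu By; have := hA _ _ Ay Av; lra.
- by have := hB _ _ Bu Bv; lra.
Qed.

Lemma diam_ball x r : (diam (ball x r) <= (2 * r)%:E)%E.
Proof.
apply: ge_ereal_sup => _ [u + [v + <-]]; rewrite ballEmdist /= lee_fin.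
move=> xu xv; have := metric_triangle u x v; rewrite (metric_sym u x); lra.
Qed.

(** A geodesic from the centre x of a ball to a point y stays in the ball: it
    has length d(x,y), so none of its points is farther than that from x. *)
Lemma geodesic_ball_connected :
  geodesic_space X -> forall x r, connected (ball x r).
Proof.
move=> geo x r; apply: (@connected_star _ _ x) => y.
rewrite ballEmdist /= => xyr; have [a [b [g [[ab cg] ga gb lg]]]] := geo x y.
rewrite -ga -gb in xyr lg *.
exists (g @` `[a, b]); split.
- apply: connected_continuous_connected => //; exact: segment_connected.
- move=> _ [t /= + <-]; rewrite in_itv /= => /andP[].
  rewrite le_eqVlt => /predU1P[<- _|at_].
    by rewrite mdistxx (le_lt_trans _ xyr) ?mdist_ge0.
  rewrite le_eqVlt => /predU1P[->|tb]; first by [].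
  (* The partition of [a, b] by the single point t bounds the length below. *)
  have : ((mdist (g a) (g t) + mdist (g t) (g b))%:E <= curve_length a b g)%E.
    apply: ereal_sup_ubound; exists [:: t; b]; last first.
      by rewrite /= !big_ord_recl big_ord0 /= addr0.
    by rewrite /= /itv_partition /= at_ tb.
  rewrite lg lee_fin => h; apply: le_lt_trans xyr.
  by have := mdist_ge0 (g t) (g b); lra.
- by exists a => //=; rewrite in_itv /= lexx.
- by exists b => //=; rewrite in_itv /= lexx ab.
Qed.

End Metric.

(** * Components of open sets when balls are connected *)

Section Components.
Context {R : realType} {X : metricType R}.
Hypothesis ballC : forall (x : X) (r : R), connected (ball x r).
Implicit Types (A O : set X) (x y : X).

Lemma component_open O x : open O -> open (connected_component O x).
Proof.
move=> /open_mdistP oO; apply/open_mdistP => y Ky.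
have [r r0 rO] := oO y (connected_component_sub Ky); exists r => //.
rewrite (same_connected_component Ky).
by apply: connected_component_max => //; exact: ballxx.
Qed.

(** Components are relatively closed: a small ball around an adherent point is
    connected and meets the component.  Hence boundary points of a component of
    O lie outside O. *)
Lemma component_closure O x y : open O -> O y ->
  closure (connected_component O x) y -> connected_component O x y.
Proof.
move=> /open_mdistP oO Oy /closure_mdistP clKy.
have [r r0 rO] := oO y Oy; have [z Kz yz] := clKy r r0.
rewrite (same_connected_component Kz).
have Bz : ball y r z by rewrite ballEmdist.
by apply: (connected_component_max Bz rO); [exact: ballC|exact: ballxx].
Qed.

End Components.

(** * Distance to the complement *)

Section Depth.
Context {R : realType} {X : metricType R}.
(* The point z0 makes the complement nonempty; the infimum of an empty set of
   reals is a junk value. *)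
Variables (Omega : set X) (z0 : X).
Hypothesis Oz0 : ~ Omega z0.
Implicit Types (x y z : X).

Definition depth x : R := inf [set mdist x z | z in ~` Omega].

Lemma depth_le x z : ~ Omega z -> depth x <= mdist x z.
Proof.
by move=> Oz; apply: ge_inf; [exists 0 => _ [y _ <-]; exact: mdist_ge0|exists z].
Qed.

Lemma le_depth x r : (forall z, ~ Omega z -> r <= mdist x z) -> r <= depth x.
Proof.
move=> h; apply: lb_le_inf; first by exists (mdist x z0); exists z0.
by move=> _ [z Oz <-]; exact: h.
Qed.

Lemma depth_lipschitz x y : depth x <= mdist x y + depth y.
Proof.
rewrite -lerBlDl; apply: le_depth => z /(depth_le x).
by have := metric_triangle x y z; lra.
Qed.

Lemma depth_gt0 x : open Omega -> Omega x -> 0 < depth x.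
Proof.
move=> /open_mdistP oO /oO[r r0 rO]; apply: (lt_le_trans r0).
apply: le_depth => z Oz; rewrite leNgt; apply/negP => xz; apply: Oz; apply: rO.
by rewrite ballEmdist.
Qed.

Lemma ball_depth x r : r <= depth x -> ball x r `<=` Omega.
Proof.
move=> rx y; rewrite ballEmdist /= => xy; apply: contrapT => /(depth_le x).
by lra.
Qed.

Lemma closure_depth A x r : (forall y, A y -> depth y <= r) ->
  closure A x -> depth x <= r.
Proof.
move=> Ar /closure_mdistP Ax; rewrite leNgt; apply/negP => rx.
have [|y /Ar yr xy] := Ax (depth x - r); first by rewrite subr_gt0.
by have := depth_lipschitz x y; lra.
Qed.

End Depth.

(** * The Mazurkiewicz distance *)

Section Mazurkiewicz.
Context {R : realType} {X : metricType R}.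
Implicit Types (Omega A B V : set X) (x y z : X) (r s : R).

Lemma mazurkiewicz_ltP Omega x y (r : \bar R) :
  (mazurkiewicz_dist Omega x y < r)%E <->
  exists A, [/\ connected A, A `<=` Omega, A x, A y & (diam A < r)%E].
Proof.
split=> [/ereal_inf_lt[_ [A [cA AO Ax Ay] <-] Ar]|[A [cA AO Ax Ay Ar]]].
  by exists A.
by apply: le_lt_trans Ar; apply: ereal_inf_lbound; exists A.
Qed.

Lemma mazurkiewicz_sym Omega x y :
  mazurkiewicz_dist Omega x y = mazurkiewicz_dist Omega y x.
Proof.
by congr ereal_inf; apply/seteqP; split=> _ [A [cA AO Ax Ay] <-]; exists A.
Qed.

Lemma mazurkiewicz_triangle Omega x y z r s :
  (mazurkiewicz_dist Omega x y < r%:E)%E ->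
  (mazurkiewicz_dist Omega y z < s%:E)%E ->
  (mazurkiewicz_dist Omega x z < (r + s)%:E)%E.
Proof.
move=> /mazurkiewicz_ltP[A [cA AO Ax Ay dA]].
move=> /mazurkiewicz_ltP[B [cB BO By Bz dB]].
apply/mazurkiewicz_ltP; exists (A `|` B); split.
- by apply: connectedU => //; exists y.
- by rewrite subUset.
- by left.
- by right.
- exact: diam_setU Ay By dA dB.
Qed.

Lemma mdist_le_mazurkiewicz Omega x y :
  ((mdist x y)%:E <= mazurkiewicz_dist Omega x y)%E.
Proof.
apply: le_ereal_inf_tmp => _ [A [_ _ Ax Ay] <-]; exact: mdist_le_diam.
Qed.

Lemma mazurkiewicz_ball Omega x y r :
  connected (ball x r) -> ball x r `<=` Omega -> ball x r y ->
  (mazurkiewicz_dist Omega y x < (3 * r)%:E)%E.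
Proof.
move=> cB rO xy; have r0 : 0 < r.
  by move: xy; rewrite ballEmdist; apply: le_lt_trans; exact: mdist_ge0.
apply/mazurkiewicz_ltP; exists (ball x r); split=> //; first exact: ballxx.
by apply: le_lt_trans (diam_ball x r) _; rewrite lte_fin; lra.
Qed.

Lemma mazurkiewicz_slack Omega x y r : (mazurkiewicz_dist Omega x y < r%:E)%E ->
  exists2 e, 0 < e & (mazurkiewicz_dist Omega x y < (r - e)%:E)%E.
Proof.
move=> /mazurkiewicz_ltP[A [cA AO Ax Ay /(diam_fin Ax)[a ar dA]]].
exists ((r - a) / 2); first lra.
by apply/mazurkiewicz_ltP; exists A; split=> //; rewrite dA lte_fin; lra.
Qed.

End Mazurkiewicz.

(** * Bounded sets in doubling spaces are totally bounded *)

Section TotallyBounded.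
Context {R : realType}.

Definition totally_bounded (X : metricType R) (A : set X) : Prop :=
  forall s : R, 0 < s -> exists n (c : nat -> X),
    forall x, A x -> exists2 i, (i < n)%N & mdist (c i) x < s.

(** A family of s-separated points of maximal size is an s-net, as a point far
    from all of them could be added to the family. *)
Lemma bounded_separated_net (X : metricType R) (A : set X) (a : X) (s : R)
    (m : nat) :
  A a ->
  (forall n (c : nat -> X), (forall i, (i < n)%N -> A (c i)) ->
     (forall i j, (i < j < n)%N -> s <= mdist (c i) (c j)) -> (n <= m)%N) ->
  exists n (c : nat -> X),
    forall x, A x -> exists2 i, (i < n)%N & mdist (c i) x < s.
Proof.
move=> Aa bnd.
pose P n := `[< exists c : nat -> X, (forall i, (i < n)%N -> A (c i)) /\
  forall i j, (i < j < n)%N -> s <= mdist (c i) (c j) >].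
have P0 : exists n, P n.
  by exists 0%N; apply/asboolP; exists (fun=> a); split=> // i j; rewrite andbF.
have Pm n : P n -> (n <= m)%N by move=> /asboolP[c [Ac sc]]; exact: bnd Ac sc.
have [n /asboolP[c [Ac sc]] nmax] := ex_maxnP P0 Pm.
exists n, c => x Ax; apply: contrapT => far.
suff /nmax : P n.+1 by rewrite ltnn.
apply/asboolP; exists (fun i => if i == n then x else c i); split=> [i|i j].
  by rewrite ltnS leq_eqVlt; case: eqP => //= _; exact: Ac.
move=> /andP[ij]; rewrite ltnS leq_eqVlt => /predU1P[jn|jn].
  rewrite jn eqxx ltn_eqF -?jn// leNgt; apply/negP => ?; apply: far.
  by exists i; rewrite -?jn.
by rewrite !ltn_eqF ?(ltn_trans ij)//; apply: sc; rewrite ij.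
Qed.

Context {X : completeMetricType R}.
Variable mu : {measure set (borel X) -> \bar R}.

Lemma measurable_ball (x : X) (r : R) : measurable (ball x r : set (borel X)).
Proof. by apply: sub_sigma_algebra; exact: open_mball. Qed.

Lemma doubling_iter : doubling_measure mu -> exists2 C : R, 1 <= C & forall n x r,
  0 < r -> (mu (ball x (2 ^+ n * r)) <= (C ^+ n)%:E * mu (ball x r))%E.
Proof.
move=> [_ [C C1 dbl]]; exists C => //; elim=> [|n IH] x r r0.
  by rewrite !expr0 mul1r mul1e.
rewrite !exprS -mulrA EFinM -muleA.
apply: (le_trans (dbl _ _ _)); first by rewrite mulr_gt0// exprn_gt0.
by rewrite lee_pmul2l ?lte_fin ?(lt_le_trans ltr01)//; exact: IH.
Qed.

(** The balls of radius s/2 around s-separated points of A are disjoint and lie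
    in one ball B of finite measure, while by doubling each of them has at
    least a fixed fraction of the measure of B.  This bounds their number. *)
Lemma doubling_totally_bounded (A : set X) :
  doubling_measure mu -> (diam A < +oo)%E -> totally_bounded A.
Proof.
move=> dbl dA s s0.
have [[a Aa]|A0] := pselect (A !=set0); last first.
  by exists 0%N, (fun=> point) => x Ax; case: A0; exists x.
have [D AD] : exists D : R, forall x y, A x -> A y -> mdist x y <= D.
  exists (fine (diam A)) => x y Ax Ay; rewrite -lee_fin fineK ?mdist_le_diam//.
  rewrite fin_numE; apply/andP; split; last by rewrite lt_eqF.
  by apply/eqP => d0; have := mdist_le_diam Ax Ax; rewrite d0.
have D0 : 0 <= D by rewrite -(mdistxx a) AD.
have [C C1 iter] := doubling_iter dbl.
have [h h0 sh] : exists2 h, 0 < h & s = h + h by exists (s / 2); lra.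
(* B below lies in the ball of radius 2 * D + h around any point of A. *)
have [N ND] : exists N : nat, 2 * D + h <= 2 ^+ N * h.
  exists (Num.bound ((2 * D + h) / h)); rewrite -ler_pdivrMr//.
  have : 0 <= (2 * D + h) / h by apply: divr_ge0; lra.
  move=> /archi_boundP/ltW/le_trans; apply.
  by rewrite -natrX ler_nat; exact/ltnW/ltn_expl.
pose B := ball a (D + h).
have /andP[B0 Boo] : (0 < mu B < +oo)%E by apply: dbl.1; lra.
have Bfin : mu B \is a fin_num by rewrite ge0_fin_numE// ltW.
have massB x : A x -> (mu B <= (C ^+ N)%:E * mu (ball x h))%E.
  move=> Ax; apply: le_trans (iter N x h h0).
  apply: le_measure; rewrite ?inE; [exact: measurable_ball..|].
  move=> y; rewrite /B !ballEmdist /= => ay.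
  apply: lt_le_trans ND.
  by have := metric_triangle x a y; have := AD _ _ Ax Aa; lra.
apply: (@bounded_separated_net _ _ a _ (Num.bound (C ^+ N)) Aa) => n c Ac sc.
pose F i : set (borel X) := ball (c i) h.
have mF i : measurable (F i) by exact: measurable_ball.
have tF : trivIset `I_n F.
  have far i j y : (i < j < n)%N -> F i y -> F j y -> False.
    rewrite /F !ballEmdist /= => /sc ij iy jy.
    have := metric_triangle (c i) y (c j).
    by rewrite (metric_sym y); lra.
  move=> i j /= ni nj [y [iy jy]]; case: (ltngtP i j) => // ij.
    by case: (far _ _ _ _ iy jy); rewrite ij.
  by case: (far _ _ _ _ jy iy); rewrite ij.
have UB : \big[setU/set0]_(i < n) F i `<=` B.
  rewrite -bigcup_mkord => y [i /= ni]; rewrite /F /B !ballEmdist /= => iy.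
  have := metric_triangle a (c i) y; have := AD _ _ Aa (Ac i ni).
  by have : h + h = s by []; lra.
have mU : measurable (\big[setU/set0]_(i < n) F i) by exact: bigsetU_measurable.
have : (n%:R%:E * mu B <= (C ^+ N)%:E * mu B)%E.
  have -> : (n%:R%:E * mu B = \sum_(i < n) mu B)%E.
    by rewrite -(fineK Bfin) sumEFin sumr_const card_ord -EFinM mulr_natl.
  apply: (@le_trans _ _ (\sum_(i < n) (C ^+ N)%:E * mu (F i))%E).
    by apply: lee_sum => i _; exact/massB/Ac.
  rewrite -ge0_sume_distrr// -measure_semi_additive_ord_I//.
  rewrite lee_pmul2l ?lte_fin ?exprn_gt0 ?(lt_le_trans ltr01 C1)//.
  by apply: le_measure; rewrite ?inE//; exact: measurable_ball.
rewrite -(fineK Bfin) -!EFinM lee_fin ler_pM2r ?fine_gt0 ?B0// => nC.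
rewrite -(ler_nat R); apply: (le_trans nC); apply/ltW/archi_boundP.
exact: le_trans nC.
Qed.

End TotallyBounded.

(** An index that fails at some scale fails at all smaller ones, so if each of
    the n indices failed somewhere, all would fail at the smallest such scale. *)
Lemma monotone_pigeonhole {R : realType} (P : R -> nat -> Prop) n :
  (forall r s i, r <= s -> P r i -> P s i) ->
  (forall r, 0 < r -> exists2 i, (i < n)%N & P r i) ->
  exists i, forall r, 0 < r -> P r i.
Proof.
move=> Pmon; elim: n => [|n IH] Pn; first by have [//|i] := Pn 1.
apply: contrapT => noi.
have [r r0 nPr] : exists2 r, 0 < r & ~ P r n.
  apply: contrapT => h; apply: noi; exists n => r r0; apply: contrapT => nP.
  by apply: h; exists r.
apply: noi; apply: IH => s s0.
have [|i] := Pn (Num.min r s); first by rewrite lt_min r0.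
rewrite ltnS leq_eqVlt => /predU1P[-> /Pmon|iN /Pmon Pi].
  by move=> /(_ r); rewrite ge_min lexx => /(_ isT).
by exists i => //; apply: Pi; rewrite ge_min lexx orbT.
Qed.

(** * Collars and their components *)

Section Collar.
Context {R : realType} {X : metricType R}.
Hypothesis ballC : forall (x : X) (r : R), connected (ball x r).
Variables (Omega V : set X) (x0 : X).
Hypotheses (oO : open Omega) (VO : V `<=` Omega).
Hypotheses (nOx0 : ~ Omega x0).
Implicit Types (x y z v w : X) (r s d : R) (A : set X).

Let depth := depth Omega.

Definition collar d : set X :=
  [set x | [/\ Omega x, depth x < d
    & exists2 v, V v & (mazurkiewicz_dist Omega x v < d%:E)%E]].

Lemma collar_open d : open (collar d).
Proof.
apply/open_mdistP => x [Ox xd [v Vv /mazurkiewicz_slack[e e0 xv]]].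
have x_gt0 := depth_gt0 nOx0 oO Ox.
pose r := Num.min (depth x) (Num.min (d - depth x) (e / 3)).
have r0 : 0 < r by rewrite !lt_min x_gt0 subr_gt0 xd divr_gt0.
have [rx [rd re]] : r <= depth x /\ r <= d - depth x /\ r <= e / 3.
  by rewrite /r !ge_min !lexx !orbT.
have rO := ball_depth rx.
exists r => // y xy; split; first exact: rO.
  have := depth_lipschitz nOx0 y x; rewrite -/depth metric_sym.
  by move: xy; rewrite ballEmdist /=; lra.
exists v => //.
apply: lt_le_trans (mazurkiewicz_triangle
  (mazurkiewicz_ball (@ballC x r) rO xy) xv) _.
by rewrite lee_fin; lra.
Qed.

Lemma collar_mono d e : d <= e -> collar d `<=` collar e.
Proof.
move=> de x [Ox xd [v Vv xv]]; split=> //; first exact: lt_le_trans de.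
by exists v => //; apply: lt_le_trans xv _; rewrite lee_fin.
Qed.

Lemma sub_collar v d : 0 < d -> V v -> depth v < d -> collar d v.
Proof.
move=> d0 Vv vd; split=> //; first exact: VO.
exists v => //; apply/mazurkiewicz_ltP; exists [set v].
split=> //; [exact: connected1|by move=> _ ->; exact: VO|].
apply: (@le_lt_trans _ _ 0%E); last by rewrite lte_fin.
by apply: ge_ereal_sup => _ [_ -> [_ -> <-]]; rewrite mdistxx.
Qed.

Hypothesis cV : connected V.
Variable v0 : X.
Hypothesis Vv0 : V v0.

(** Otherwise the points of V that lie in the component of v and have depth less
    than h would form a clopen part of V: at an adherent point of V the depth
    is at most h < d, so that point is in the collar, hence in the component,
    and its depth cannot be h.  As V is connected, this part would be all of V
    and contain v0, whose depth is at least h. *)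
Lemma collar_component_level v d h : V v -> depth v < h -> h < d ->
  h <= depth v0 -> 0 < h ->
  exists2 w, V w & depth w = h /\ connected_component (collar d) v w.
Proof.
move=> Vv vh hd hv0 h0; apply: contrapT => noW.
pose K := connected_component (collar d) v.
pose L := K `&` [set x | depth x < h].
have Lv : L v.
  by split=> //; apply/connected_component_refl/sub_collar => //; lra.
suff VL : V `&` L = V.
  by move: Vv0; rewrite -VL => -[_ [_ /=]]; rewrite ltNge hv0.
apply: cV; first by exists v.
  exists L => //; apply: openI; first exact/component_open/collar_open.
  apply/open_mdistP => x /= xh; exists (h - depth x); first by rewrite subr_gt0.
  move=> y; rewrite ballEmdist /= => xy; have := depth_lipschitz nOx0 y x.
  by rewrite -/depth metric_sym; lra.
exists (closure L); first exact: closed_closure.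
apply/seteqP; split=> z [Vz Lz]; split=> //; first exact: subset_closure.
have zh : depth z <= h.
  by apply: (closure_depth nOx0) Lz => y [_ /ltW].
have Kz : K z.
  apply: component_closure => //; first exact: collar_open.
    by apply: sub_collar => //; lra.
  by apply: closureS Lz => y [].
split=> //=; rewrite lt_neqAle zh andbT; apply/eqP => zE.
by apply: noW; exists z.
Qed.

Definition meets_near A : Prop :=
  forall r, 0 < r -> exists2 v, A v & V v /\ mdist x0 v < r.

Hypothesis tbO : totally_bounded Omega.

(** Through each point of A and V near x0 there is a component of the collar
    that contains a point w of V of depth d/2.  By total boundedness these w
    fall into one ball of radius d/8 for points arbitrarily close to x0.  All
    points of this ball have depth between d/4 and 3d/4 and are close to w, so
    the ball is contained in the collar, and the components that meet it are
    the same. *)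
Lemma component_meets_near A d : 0 < d -> d / 2 <= depth v0 ->
  meets_near A ->
  exists w, meets_near (A `&` connected_component (collar d) w).
Proof.
move=> d0 dv0 accA; have [hd h0] : d / 2 < d /\ 0 < d / 2 by lra.
have [|n [c cover]] := tbO (s := d / 8); first lra.
pose P r i := exists v w, [/\ A v, V v, mdist x0 v < r,
  [/\ V w, depth w = d / 2 & connected_component (collar d) v w]
  & mdist (c i) w < d / 8].
have [r s i rs|r r0|i Pi] := @monotone_pigeonhole _ P n.
- move=> [v [w [Av Vv vr ww ciw]]]; exists v, w; split=> //.
  exact: lt_le_trans rs.
- have [|v Av [Vv]] := accA (Num.min r (d / 2)); first by rewrite lt_min; lra.
  rewrite lt_min => /andP[vr vd].
  have vd2 : depth v < d / 2.
    by have := depth_le v nOx0; rewrite metric_sym -/depth; lra.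
  have [w Vw [wd vw]] := collar_component_level Vv vd2 hd dv0 h0.
  by have [j jn cw] := cover w (VO Vw); exists j => //; exists v, w.
have [_ [w1 [_ _ _ [Vw1 w1d _] ciw1]]] := Pi 1 ltr01.
pose B := ball (c i) (d / 8).
have Bw1 : B w1 by rewrite /B ballEmdist.
have BO : B `<=` Omega.
  move=> z; rewrite /B ballEmdist /= => cz.
  apply: (@ball_depth _ _ _ w1 (d / 2)); first by rewrite -w1d.
  rewrite ballEmdist /=; have := metric_triangle w1 (c i) z.
  by rewrite (metric_sym w1 (c i)); lra.
have BK : B `<=` connected_component (collar d) w1.
  apply: (connected_component_max Bw1); last exact: ballC.
  move=> z Bz; split; first exact: BO.
    have := depth_lipschitz nOx0 z w1; have := metric_triangle z (c i) w1.
    rewrite (metric_sym z (c i)) -/depth.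
    by move: Bz; rewrite /B ballEmdist /=; lra.
  exists w1 => //; apply/mazurkiewicz_ltP; exists B.
  split=> //; first exact: ballC.
  by apply: le_lt_trans (diam_ball (c i) (d / 8)) _; rewrite lte_fin; lra.
exists w1 => r r0; have [v [w [Av Vv vr [Vw wd vw] ciw]]] := Pi r r0.
exists v => //; split=> //.
apply: (@connected_component_trans _ _ w).
  by apply: BK; rewrite /B ballEmdist.
exact: connected_component_sym.
Qed.

(** The component found at stage k+1 shares a point with the one at stage k, and
    the collars decrease, so the components are nested. *)
Lemma nested_components (e : nat -> R) :
  (forall k, 0 < e k) -> (forall k, e k / 2 <= depth v0) ->
  (forall k, e k.+1 <= e k) -> meets_near setT ->
  exists w : nat -> X, forall k,
    let K k := connected_component (collar (e k)) (w k) in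
    meets_near (K k) /\ K k.+1 `<=` K k.
Proof.
move=> e0 ev0 emono acc.
pose K (p : nat * X) := connected_component (collar (e p.1)) p.2.
have [w0 acc0] := component_meets_near (e0 0) (ev0 0) acc.
rewrite setTI in acc0.
pose S := {p | meets_near (K p)}.
have step (p : S) :
    {q : S | (sval q).1 = (sval p).1.+1 /\ K (sval q) `<=` K (sval p)}.
  case: p => -[k w] accw /=; apply: cid.
  have [w' accw'] := component_meets_near (e0 k.+1) (ev0 k.+1) accw.
  have accK : meets_near (K (k.+1, w')).
    by move=> r /accw'[v [_ Kv]]; exists v.
  exists (exist _ (k.+1, w') accK); split=> //= y Ky.
  have [v [Kv K'v] _] := accw' 1 ltr01.
  apply: connected_component_trans Kv _.
  apply: (component_mono (collar_mono (emono k))).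
  exact: connected_component_trans (connected_component_sym K'v) Ky.
have [f [f0 fS]] := dependent_choice step (exist _ (0%N, w0) acc0).
have f1 k : (sval (f k)).1 = k by elim: k => [|k IH]; rewrite ?f0// (fS k).1 IH.
exists (fun k => (sval (f k)).2) => k /=; split.
  by have := svalP (f k); rewrite /K f1.
by have := (fS k).2; rewrite /K !f1.
Qed.

(** A point y in the closure of a component of the a-collar has depth at most a
    and is a limit, for d_M as well, of points within a of V.  If x is within
    b - a of y then x belongs to the b-collar, so it cannot be a boundary point
    of one of its components. *)
Lemma component_separation a b w w' : a < b ->
  connected_component (collar a) w' `<=` connected_component (collar b) w ->
  (0 < mazurkiewicz_set_dist Omega
     (Omega `&` boundary (connected_component (collar b) w))
     (Omega `&` boundary (connected_component (collar a) w')))%E.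
Proof.
move=> ab sub; apply: (@lt_le_trans _ _ (b - a)%:E).
  by rewrite lte_fin subr_gt0.
apply: le_ereal_inf_tmp => _ [x [Ox [clx nix]] [y [Oy [cly _]] <-]].
rewrite leNgt; apply/negP => xy; apply: nix.
suff : connected_component (collar b) w x.
  move=> Kx; apply: open_nbhs_nbhs; split=> //.
  exact/component_open/collar_open.
apply: component_closure => //; first exact: collar_open.
have ya : depth y <= a.
  by apply: (closure_depth nOx0) cly => z /connected_component_sub[_ /ltW].
split=> //.
  have := le_lt_trans (mdist_le_mazurkiewicz Omega x y) xy; rewrite lte_fin.
  by have := depth_lipschitz nOx0 x y; rewrite -/depth; lra.
have [s s0 xys] := mazurkiewicz_slack xy.
have [r r0 rO] : exists2 r, 0 < r & ball y r `<=` Omega.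
  by move/open_mdistP : oO; exact.
have m0 : 0 < Num.min r (s / 3) by rewrite lt_min r0 divr_gt0.
have [z Kz yz] := (closure_mdistP _ _).1 cly _ m0.
have [_ _ [v Vv zv]] := connected_component_sub Kz; exists v => //.
have yz' : (mazurkiewicz_dist Omega y z < (3 * Num.min r (s / 3))%:E)%E.
  rewrite mazurkiewicz_sym; apply: mazurkiewicz_ball; first exact: ballC.
    by apply: subset_trans rO; apply: le_ball; rewrite ge_min lexx.
  by rewrite ballEmdist.
have := mazurkiewicz_triangle (mazurkiewicz_triangle xys yz') zv.
move=> /lt_le_trans; apply; rewrite lee_fin.
have : Num.min r (s / 3) <= s / 3 by rewrite ge_min lexx orbT.
lra.
Qed.

(** The bound on the depth forces the impression out of Omega, and every set of
    the chain is acceptable because x0 is adherent to it. *)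
Lemma collar_chain : meets_near setT -> exists2 E, chain Omega E &
  forall d, 0 < d -> exists k, E k `<=` collar d.
Proof.
move=> acc; have v0_gt0 := depth_gt0 nOx0 oO (VO Vv0); rewrite -/depth in v0_gt0.
pose e k : R := depth v0 / k.+1%:R.
have e0 k : 0 < e k by rewrite divr_gt0.
have ev0 k : e k / 2 <= depth v0.
  have : e k <= depth v0 by rewrite ler_pdivrMr// ler_peMr ?ler1n// ltW.
  by have := e0 k; lra.
have elt k : e k.+1 < e k.
  by rewrite /e ltr_pM2l// ltf_pV2 ?posrE// ltr_nat.
have [w Kw] := nested_components e0 ev0 (fun k => ltW (elt k)) acc.
pose E k := connected_component (collar (e k)) (w k).
have small d : 0 < d -> exists k, e k < d.
  move=> d0; exists (Num.bound (depth v0 / d)).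
  rewrite /e ltr_pdivrMr// mulrC -ltr_pdivrMr//.
  apply: (lt_trans (archi_boundP _)); last by rewrite ltr_nat.
  by rewrite divr_ge0// ltW.
have EO k : E k `<=` Omega by move=> x /connected_component_sub[].
have Ee k x : closure (E k) x -> depth x <= e k.
  by apply: (closure_depth nOx0) => z /connected_component_sub[_ /ltW].
have bdO x : closure Omega x -> ~ Omega x -> boundary Omega x.
  by move=> clx nx; split=> //; rewrite (iffLR (interior_id _) oO).
exists E; last first.
  move=> d /small[k ekd]; exists k.
  by move=> x /connected_component_sub; apply: collar_mono; exact: ltW.
split=> [k|k|k|x Ix].
- split; [exact: EO|exact: component_connected|exists x0].
  have cx0 : closure (E k) x0.
    by apply/closure_mdistP => r /(Kw k).1[v Kv [_ ?]]; exists v.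
  by split=> //; apply: bdO => //; apply: closureS cx0; exact: EO.
- exact: (Kw k).2.
- by apply: component_separation => //; exact: (Kw k).2.
- apply: bdO; first by have := Ix 0%N I; apply: closureS; exact: EO.
  move=> /(depth_gt0 nOx0 oO)/small[k]; apply/negP; rewrite -leNgt.
  exact/Ee/Ix.
Qed.

End Collar.

(** * Ends *)

Section Ends.
Context {R : realType} {X : metricType R}.
Implicit Types (Omega V : set X) (E F : nat -> set X).

Lemma chain_mono Omega E i j : chain Omega E -> (i <= j)%N -> E j `<=` E i.
Proof.
move=> [_ Emono _ _] /subnK <-; elim: (j - i)%N => //= n IH.
exact: subset_trans (Emono _) IH.
Qed.

(** If F_j misses V, a point x of F_(j+1) deep enough in the chain F is also a
    point of some E_k, so it is joined to a point v of V by a connected set of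
    diameter smaller than the distance of the boundaries of F_j and F_(j+1).
    This set contains x, which is in both F_j and F_(j+1), and v, which is in
    neither, so it meets both boundaries. *)
Lemma divides_from_side Omega V E F : chain Omega F -> divides F E ->
  (forall d : R, 0 < d -> exists k, forall x, E k x ->
     exists2 v, V v & (mazurkiewicz_dist Omega x v < d%:E)%E) ->
  from_side V F.
Proof.
move=> chF FE near j; apply: contrapT => FjV0.
have [acc _ sep _] := chF.
have [d d0 dsep] : exists2 d : R, 0 < d &
    (d%:E <= mazurkiewicz_set_dist Omega (Omega `&` boundary (F j))
                                  (Omega `&` boundary (F j.+1)))%E.
  have := sep j; case: mazurkiewicz_set_dist => [d|_|//].
    by rewrite lte_fin => d0; exists d.
  by exists 1 => //; rewrite leey.
have [k Ek] := near d d0; have [m FmEk] := FE k.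
have [x Fx] : F (maxn m j.+1) !=set0.
  have [_ _ [y [clFy _]]] := acc (maxn m j.+1).
  by have [z [Fz _]] := clFy setT filterT; exists z.
have Fj1x : F j.+1 x := chain_mono chF (leq_maxr m j.+1) Fx.
have Fjx : F j x := chain_mono chF (leqnSn j) Fj1x.
have [v Vv /mazurkiewicz_ltP[A [cA AO Ax Av Ad]]] :=
  Ek x (FmEk _ (chain_mono chF (leq_maxl m j.+1) Fx)).
have nFjv : ~ F j v by move=> Fv; apply: FjV0; exists v.
have nFj1v : ~ F j.+1 v by move=> /(chain_mono chF (leqnSn j)).
have [a [Aa ba]] := connected_boundary cA Ax Fjx Av nFjv.
have [b [Ab bb]] := connected_boundary cA Ax Fj1x Av nFj1v.
suff : (mazurkiewicz_set_dist Omega (Omega `&` boundary (F j))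
                              (Omega `&` boundary (F j.+1)) < d%:E)%E.
  by rewrite ltNge dsep.
apply: le_lt_trans Ad; apply: (@le_trans _ _ (mazurkiewicz_dist Omega a b)).
  apply: ereal_inf_lbound; exists a; first by split=> //; exact: AO.
  by exists b => //; split=> //; exact: AO.
by apply: ereal_inf_lbound; exists A.
Qed.

Lemma end_divides_trans Omega e f g : ends Omega e -> ends Omega f ->
  ends Omega g -> end_divides e f -> end_divides f g -> end_divides e g.
Proof.
move=> [E cE <-] [F cF <-] [G cG <-].
move=> /(end_dividesE cE cF) EF /(end_dividesE cF cG) FG.
exact/(end_dividesE cE cG)/(divides_trans EF).
Qed.

Lemma end_divides_anti Omega e f : ends Omega e -> ends Omega f ->
  end_divides e f -> end_divides f e -> e = f.
Proof.
move=> [E cE <-] [F cF <-] /(end_dividesE cE cF) EF /(end_dividesE cF cE) FE.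
apply/seteqP; split=> G [cG [h1 h2]]; split=> //; split.
- exact: divides_trans h1.
- exact: divides_trans h2 _.
- exact: divides_trans h1.
- exact: divides_trans h2 _.
Qed.

(** Zorn's lemma is applied to the ends dividing e0; adding e0 to a totally
    ordered family of them puts the lower bound of the family below e0 too. *)
Lemma prime_end_divides Omega e0 :
  (forall F : set (set (nat -> set X)),
     F `<=` ends Omega -> total_on F end_divides ->
     exists2 e, ends Omega e & forall f, F f -> end_divides e f) ->
  ends Omega e0 -> exists2 e, prime_end Omega e & end_divides e e0.
Proof.
move=> lower e0_end.
have edxx e : ends Omega e -> end_divides e e.
  by move=> [E cE <-]; exact/(end_dividesE cE cE)/divides_refl.
pose T := {e | ends Omega e /\ end_divides e e0}.
pose rel (s t : T) := `[< end_divides (sval t) (sval s) >].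
have [t|r s t|s t|A tot|[e [e_end ee0]] emin] := @Zorn T rel.
- by apply/asboolP/edxx; case: (svalP t).
- move=> /asboolP sr /asboolP ts; apply/asboolP.
  exact: end_divides_trans (svalP t).1 (svalP s).1 (svalP r).1 ts sr.
- move=> /asboolP ts /asboolP st; apply: eq_sig_hprop => [e|].
    exact: Prop_irrelevance.
  exact: end_divides_anti (svalP s).1 (svalP t).1 st ts.
- pose F := e0 |` (sval @` A).
  have Fe : F `<=` ends Omega.
    by move=> _ [->//|[t _ <-]]; case: (svalP t).
  have Ftot : total_on F end_divides.
    move=> _ _ [->|[s As <-]] [->|[t At <-]].
    + by left; exact: edxx.
    + by right; case: (svalP t).
    + by left; case: (svalP s).
    + by have [/asboolP|/asboolP] := tot _ _ As At; [right|left].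
  have [e e_end elow] := lower F Fe Ftot.
  have ee0 : end_divides e e0 by apply: elow; left.
  exists (exist _ e (conj e_end ee0)) => s As; apply/asboolP.
  by apply: elow; right; exists s.
- exists e => //; split=> // f f_end fe.
  have fe0 := end_divides_trans f_end e_end e0_end fe ee0.
  have /(congr1 sval) := emin (exist _ f (conj f_end fe0)) (asboolT fe).
  by [].
Qed.

End Ends.

(** * Existence of a prime end from the side of V *)

Theorem theorem5p3 (R : realType) (p : R) (X : completeMetricType R)
    (mu : {measure set (borel X) -> \bar R}) (Omega V : set X) :
  1 < p ->
  geodesic_space X ->
  doubling_measure mu ->
  poincare_inequality mu p ->
  (diam Omega < +oo)%E -> connected Omega -> open Omega ->
  (forall F : set (set (nat -> set X)),
     F `<=` ends Omega -> total_on F end_divides ->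
     exists2 e, ends Omega e & forall f, F f -> end_divides e f) ->
  V `<=` Omega -> open V -> connected V ->
  boundary Omega `&` boundary V !=set0 ->
  exists2 e, prime_end Omega e & end_from_side V e.
Proof.
move=> _ geo dbl _ dO _ oO lower VO _ cV [x0 [[_ nOx0] [clV _]]].
rewrite (iffLR (interior_id _) oO) in nOx0.
have acc : meets_near V x0 setT.
  by move=> r /((closure_mdistP _ _).1 clV)[v]; exists v.
have [v0 _ [Vv0 _]] := acc 1 ltr01.
have [E chE small] := collar_chain (geodesic_ball_connected geo) oO VO nOx0 cV
  Vv0 (doubling_totally_bounded dbl dO) acc.
have E_end : ends Omega (chain_class Omega E) by exists E.
have [e [[F chF <-] Fprime] /(end_dividesE chF chE) FE] :=
  prime_end_divides lower E_end.
exists (chain_class Omega F); first by split=> //; exists F.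
apply/(end_from_sideE _ chF)/(divides_from_side chF FE) => d /small[k Ek].
by exists k => x /Ek[].
Qed.
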